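(* Let $X$ be an infinite-dimensional Fréchet space without continuous norm, whose topology is given by an increasing sequence of seminorms $(p_n)_{n\ge1}$, let $Y$ be a separable topological vector space whose topology is given by an increasing sequence of seminorms $(q_j)_{j\ge1}$, and let $(T_k)_{k\ge 1}$ be a sequence of continuous linear operators from $X$ to $Y$. Suppose that there exist an increasing sequence $(n_k)_{k\ge 1}$ of positive integers and a set $X_0\subset X$ such that 1. for any $j\ge1$ and any $x\in X_0$, the sequence $(q_j(T_{n_k}x))_k$ is ultimately zero; 2. for any $n,K\ge1$, the set $\bigcup_{k\ge K}T_{n_k}(X_0\cap\ker p_n)$ is dense in $Y$. Then $(T_k)$ possesses a hypercyclic subspace of type $2$.
   Context: A vector $x\in X$ is hypercyclic for a sequence $(T_k)$ of operators from $X$ to $Y$ if $\{T_kx\}_k$ is dense in $Y$. A hypercyclic subspace for $(T_k)$ is a closed infinite-dimensional subspace $M$ of $X$ in which every non-zero vector is hypercyclic for $(T_k)$. A hypercyclic subspace $M$ is of type $2$ if for any continuous seminorm $p$ on $X$, the subspace $M\cap\ker p$ is infinite-dimensional. A continuous norm on $X$ is a continuous seminorm $p$ on $X$ with $\ker p=\{0\}$. *)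

(* Defs.v *)
From mathcomp Require Import all_boot all_order all_algebra.
From mathcomp Require Import all_classical all_reals all_analysis.

Set Implicit Arguments.
Unset Strict Implicit.
Unset Printing Implicit Defensive.

Import Order.TTheory GRing.Theory Num.Theory.
Import numFieldNormedType.Exports.

Local Open Scope classical_set_scope.
Local Open Scope ring_scope.

(* The scalar field is a numFieldType K, to be taken equal to R or R[i] for a
   realType R.  As for norms in MathComp, real-valued functions take their
   values in K itself: [0 <= a] and [0 < e] in R[i] entail that a and e are
   real.
   Topological vector spaces are elements of topologicalLmodType K.  In a
   tvsType the uniform structure need not be the translation-invariant one, so
   completeness is stated below directly for the additive uniformity. *)

Section TopologicalVectorSpaces.
Context {K : numFieldType} {X : topologicalLmodType K}.
Implicit Types (p : X -> K) (M : set X).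

Definition seminorm p : Prop :=
  [/\ forall x, 0 <= p x,
      forall x y, p (x + y) <= p x + p y
    & forall (a : K) x, p (a *: x) = `|a| * p x].

Definition continuous_seminorm p : Prop := seminorm p /\ continuous p.

Definition ker p : set X := [set x | p x = 0].

Definition continuous_norm p : Prop :=
  continuous_seminorm p /\ ker p = [set 0].

Definition topology_given_by (p : nat -> X -> K) : Prop :=
  forall (x : X) (A : set X), nbhs x A <->
    exists n (e : K), 0 < e /\
      [set y | forall i, (i <= n)%N -> p i (y - x) < e] `<=` A.

(* Sequences indexed by n >= 1 in the mathematics are indexed by nat here. *)
Definition increasing_seminorms (p : nat -> X -> K) : Prop :=
  [/\ forall n, seminorm (p n),
      forall x, nondecreasing_seq (p ^~ x)
    & topology_given_by p].

Definition finite_dimensional M : Prop :=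
  exists n (v : 'I_n -> X), (forall i, M (v i)) /\
    forall x, M x -> exists a : 'I_n -> K, x = \sum_(i < n) a i *: v i.

Definition infinite_dimensional M : Prop := ~ finite_dimensional M.

Definition linear_subspace M : Prop :=
  M 0 /\ forall (a : K) x y, M x -> M y -> M (a *: x + y).

End TopologicalVectorSpaces.

Definition tvs_cauchy {K : numFieldType} {X : topologicalLmodType K}
    (F : set_system X) : Prop :=
  forall U : set X, nbhs (0 : X) U ->
    exists2 A, F A & forall x y, A x -> A y -> U (x - y).

Definition tvs_complete {K : numFieldType} (X : topologicalLmodType K) : Prop :=
  forall F : set_system X, ProperFilter F -> tvs_cauchy F ->
    exists x : X, F --> x.

Definition frechet_space {K : numFieldType} (X : topologicalLmodType K) : Prop :=
  [/\ hausdorff_space X, tvs_complete X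
    & exists p : nat -> X -> K, increasing_seminorms p].

Definition separable_space (Y : topologicalType) : Prop :=
  exists2 D : set Y, countable D & dense D.

Section Hypercyclicity.
Context {K : numFieldType} {X Y : topologicalLmodType K}.
Implicit Types (T : nat -> {linear X -> Y}) (M : set X).

Definition hypercyclic T (x : X) : Prop := dense (range (fun k => T k x)).

Definition hypercyclic_subspace T M : Prop :=
  [/\ linear_subspace M, closed M, infinite_dimensional M
    & forall x, M x -> x != 0 -> hypercyclic T x].

Definition hypercyclic_subspace_type2 T M : Prop :=
  hypercyclic_subspace T M /\
  forall p : X -> K, continuous_seminorm p ->
    infinite_dimensional (M `&` ker p).

End Hypercyclicity.

(* Main.v *)
Require Import Defs.
From mathcomp Require Import all_boot all_order all_algebra.
From mathcomp Require Import complex.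
From mathcomp Require Import all_classical all_reals all_analysis.

Import Order.TTheory GRing.Theory Num.Theory.
Import numFieldNormedType.Exports.

Local Open Scope classical_set_scope.
Local Open Scope ring_scope.

(** Suppose first that some [q J] is non-zero.  The idea is to build one
    sequence [x s] of vectors and one sequence of indices [k s] that are exactly
    biorthogonal, and to let [M] be the space of all the sums
    [\sum_s a (l s) *: x s], for arbitrary scalars [a 0, a 1, ...], where
    [l] takes each value infinitely often.  Put [S s := T (nk (k s))].  The
    vectors are chosen with [p s (x s) = 0], so that modulo [ker (p n)] the sum
    is finite, and every such series converges in the complete space [X].

    The pair [(x s, k s)] is chosen after all the earlier ones
    ([biorthogonal_sequence]).  Taking [k s] large makes [S s] vanish on the
    earlier vectors, modulo [ker (q s)], because these lie in [X0].  Taking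
    [x s] in the kernel of a large [p n] makes the earlier [S i] vanish on
    [x s], modulo [ker (q i)], because a continuous operator is dominated by one
    of the seminorms.  Density still allows [S s (x s)] to approach any
    prescribed target.  As a result, for [z] in [M] with coefficients [a],
      [S s z = a (l s) *: S s (x s)]  modulo [ker (q s)]
    ([ker_series_coord_diff]), and everything follows from this equation:
    - if [a (l s0) != 0], then at the indices [s] with [l s = l s0] the vectors
      [S s z] run through multiples, by one non-zero scalar, of vectors that
      approach a whole dense sequence, so [z] is hypercyclic;
    - the coefficients depend continuously on [z], so limits of elements of [M]
      have convergent coefficients, and [M] is closed
      ([closed_ker_series_span]);
    - the coefficients are determined by [z], so the sums of the [x s] over the
      fibres of [l] are free; as [l s <= s], all but finitely many of them lie
      in a given [ker (p n)].

    Suppose now that all the [q j] vanish.  Then the topology of [Y] is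
    indiscrete, every vector is hypercyclic and [M = X] is suitable: as [X] has
    no continuous norm, every [ker (p n)] contains a non-zero vector, and hence
    infinitely many independent ones ([contains_free_sequence_ker]). *)

(** * Scalars *)

(** Completeness provides the limits of coefficients that make the subspace
    closed, and the archimedean property lets the tolerances [s.+1%:R^-1] go
    to [0].  Real and complex scalars are treated alike from these two. *)
Definition cauchy_complete_field (K : numFieldType) : Prop :=
  forall a : nat -> K,
    (forall e : K, 0 < e ->
       exists N, forall m n, (N <= m)%N -> (N <= n)%N -> `|a m - a n| < e) ->
    exists l : K, a @ \oo --> l.

Definition archimedean_field (K : numFieldType) : Prop :=
  forall e : K, 0 < e ->
    exists N, forall n, (N <= n)%N -> n.+1%:R^-1 < e.

Lemma real_cauchy_complete (R : realType) : cauchy_complete_field R.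
Proof.
move=> a ca.
suff /cauchy_cvg/cvg_ex : cauchy (a @ \oo) by [].
apply/cauchy_exP => e e0; have [N HN] := ca e e0.
exists (a N); exists N => // n /= Nn.
by rewrite /ball /=; exact: HN.
Qed.

Lemma real_archimedean (R : realType) : archimedean_field R.
Proof.
move=> e e0; have [N _ HN] := near_infty_natSinv_lt (PosNum e0).
by exists N => n Nn; exact: HN.
Qed.

(** The real and imaginary parts of a Cauchy sequence are Cauchy sequences. *)
Lemma complex_cauchy_complete (R : realType) :
  cauchy_complete_field (R[i] : numFieldType).
Proof.
move=> a ca.
have Re_norm (z : R[i]) : `|complex.Re z|%:C%C <= `|z| by exact: normc_ge_Re.
have Im_norm (z : R[i]) : `|complex.Im z|%:C%C <= `|z|.
  rewrite normc_def lecR -sqrtr_sqr ler_wsqrtr //.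
  by rewrite lerDr sqr_ge0.
have norm_Re_Im (z : R[i]) :
    `|z| <= (`|complex.Re z| + `|complex.Im z|)%:C%C.
  rewrite normc_def lecR -[leRHS]ger0_norm ?addr_ge0 // -sqrtr_sqr.
  rewrite ler_wsqrtr // sqrrD !real_normK ?num_real //.
  by rewrite lerD2r lerDl mulrn_wge0 // mulr_ge0.
have part (f : R[i] -> R) :
    (forall z, `|f z|%:C%C <= `|z|) -> (forall z w, f (z - w) = f z - f w) ->
    exists l : R, (f \o a) @ \oo --> l.
  move=> fle fB; apply: real_cauchy_complete => e e0.
  have [|N HN] := ca e%:C%C; first by rewrite ltcR.
  exists N => m n Nm Nn; rewrite /= -fB -ltcR.
  exact: le_lt_trans (fle _) (HN _ _ Nm Nn).
have [|x Hx] := part _ Re_norm; first by case=> ? ? [].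
have [|y Hy] := part _ Im_norm; first by case=> ? ? [].
exists (x +i* y)%C; apply/cvgrPdist_lt => e e0.
have e2 : 0 < complex.Re e / 2.
  by move: e0; rewrite ltcE /= => /andP[_ e0]; rewrite divr_gt0.
have -> : e = (complex.Re e / 2 + complex.Re e / 2)%:C%C.
  move: e0; rewrite ltcE -splitr; case: e e2 => r s _ /=.
  by move=> /andP[/eqP ->].
move/cvgrPdist_lt: Hx => /(_ _ e2) Hx; move/cvgrPdist_lt: Hy => /(_ _ e2) Hy.
near=> n; apply: le_lt_trans (norm_Re_Im _) _; rewrite ltcR.
have -> : complex.Re ((x +i* y)%C - a n) = x - complex.Re (a n).
  by case: (a n).
have -> : complex.Im ((x +i* y)%C - a n) = y - complex.Im (a n).
  by case: (a n).
by rewrite ltrD //; [near: n; exact: Hx | near: n; exact: Hy].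
Unshelve. all: by end_near. Qed.

Lemma complex_archimedean (R : realType) :
  archimedean_field (R[i] : numFieldType).
Proof.
move=> e e0.
move: (e0); rewrite ltcE /= => /andP[/eqP ei e1].
have [N HN] := real_archimedean R _ e1; exists N => n Nn.
have -> : e = (complex.Re e)%:C%C by move: ei; case: e {e0 e1 HN} => r s /= ->.
have -> : (n.+1%:R^-1 : R[i]) = (n.+1%:R^-1)%:C%C.
  by rewrite fmorphV rmorph_nat.
by rewrite ltcR; exact: HN.
Qed.

(** * Free sequences *)

Section LinearAlgebra.
Context {K : numFieldType} {V : topologicalLmodType K}.

(** A convenient certificate of infinite dimension: unlike
    [infinite_dimensional], it obviously passes to larger sets. *)
Definition contains_free_sequence (M : set V) : Prop :=
  exists2 u : nat -> V, (forall i, M (u i)) &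
    forall n (c : nat -> K), \sum_(i < n) c i *: u i = 0 ->
      forall i, (i < n)%N -> c i = 0.

Lemma contains_free_sequenceS (M N : set V) : M `<=` N ->
  contains_free_sequence M -> contains_free_sequence N.
Proof. by move=> MN [u Mu ufree]; exists u => // i; exact: MN. Qed.

(** More vectors than spanning vectors: the matrix of coefficients has a
    non-trivial left kernel, which gives a linear relation. *)
Lemma infinite_dimensional_of_free_sequence (M : set V) :
  contains_free_sequence M -> infinite_dimensional M.
Proof.
move=> [u Mu ufree] [n [v [_ vspan]]].
have [a Ha] := choice (fun i => vspan _ (Mu i)).
pose A := \matrix_(i < n.+1, j < n) a i j.
have /rowV0Pn[w /sub_kermxP wA w0] : kermx A != 0.
  rewrite -mxrank_eq0 mxrank_ker subn_eq0 -ltnNge ltnS.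
  exact: rank_leq_col.
have [i wi] : exists i, w 0 i != 0.
  apply: contrapT => /forallNP w00; move/eqP: w0; apply.
  by apply/rowP => i; rewrite mxE; apply: contrapT => /eqP; exact: w00.
move/eqP: wi; apply.
rewrite -(inord_val i); apply: (ufree n.+1 (fun k => w 0 (inord k))) => //.
under eq_bigr => k _ do rewrite inord_val Ha scaler_sumr.
rewrite exchange_big /= big1 // => j _.
under eq_bigr => k _ do rewrite scalerA.
rewrite -scaler_suml.
move/rowP: wA => /(_ j); rewrite !mxE => wAj.
rewrite [X in X *: _](_ : _ = 0) ?scale0r //; apply: etrans wAj.
by apply: eq_bigr => k _; rewrite mxE.
Qed.

End LinearAlgebra.

(** * Recursive choices *)

(** Constructs a sequence whose terms are related pairwise, each term being
    chosen in view of all the previous ones.  The past is handed to the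
    hypothesis as a total function, of which only the first [n] values are
    constrained; this avoids dependent types. *)
Lemma recursive_choice {A : Type} (a0 : A) (Q : nat -> A -> Prop)
    (P : nat -> nat -> A -> A -> Prop) :
  (forall n (f : nat -> A), (forall i, (i < n)%N -> Q i (f i)) ->
     exists a, Q n a /\ forall i, (i < n)%N -> P i n (f i) a) ->
  exists f : nat -> A, forall n,
    Q n (f n) /\ forall i, (i < n)%N -> P i n (f i) (f n).
Proof.
move=> step.
have /choice[g Hg] (nf : nat * (nat -> A)) : exists a : A,
    (forall i, (i < nf.1)%N -> Q i (nf.2 i)) ->
    Q nf.1 a /\ forall i, (i < nf.1)%N -> P i nf.1 (nf.2 i) a.
  case: nf => n f /=.
  have [/(step n f)[a Ha]|?] := pselect (forall i, (i < n)%N -> Q i (f i)).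
    by exists a.
  by exists a0.
pose hist := fix hist n : seq A :=
  if n is m.+1 then rcons (hist m) (g (m, nth a0 (hist m))) else [::].
pose f n := g (n, nth a0 (hist n)).
have size_hist n : size (hist n) = n.
  by elim: n => //= n; rewrite size_rcons => ->.
have nth_hist n i : (i < n)%N -> nth a0 (hist n) i = f i.
  elim: n => // n IH; rewrite ltnS leq_eqVlt /= nth_rcons size_hist.
  by case/predU1P => [->|in_]; rewrite ?ltnn ?eqxx // in_ IH.
exists f => n; elim/ltn_ind: n => n IH.
have [|Qn Pn] := Hg (n, nth a0 (hist n)).
  by move=> i /= ilt; rewrite nth_hist //; case: (IH i ilt).
by split=> // i ilt; have := Pn i ilt; rewrite /= nth_hist.
Qed.

Lemma uniform_threshold (P : nat -> nat -> Prop) (n : nat) :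
  (forall i, (i < n)%N -> exists N, forall k, (N <= k)%N -> P i k) ->
  exists N, forall i k, (i < n)%N -> (N <= k)%N -> P i k.
Proof.
elim: n => [|n IH] H; first by exists 0%N.
have [i ltin|N1 HN1] := IH; first by apply: H; rewrite ltnS ltnW.
have [//|N2 HN2] := H n.
exists (maxn N1 N2) => i k; rewrite ltnS leq_eqVlt geq_max.
by case/predU1P => [->|ltin] /andP[? ?]; [exact: HN2 | exact: HN1].
Qed.

(** * Seminorms *)

Section Seminorm.
Context {K : numFieldType} {V : topologicalLmodType K} {r : V -> K}.
Hypothesis hr : seminorm r.

Lemma seminorm_ge0 x : 0 <= r x. Proof. by case: hr. Qed.

Lemma seminormD x y : r (x + y) <= r x + r y. Proof. by case: hr. Qed.

Lemma seminormZ (a : K) x : r (a *: x) = `|a| * r x.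
Proof. by case: hr. Qed.

Lemma seminorm0 : r 0 = 0.
Proof. by rewrite -(scale0r 0) seminormZ normr0 mul0r. Qed.

Lemma seminormN x : r (- x) = r x.
Proof. by rewrite -scaleN1r seminormZ normrN1 mul1r. Qed.

Lemma seminorm_distC x y : r (x - y) = r (y - x).
Proof. by rewrite -seminormN opprB. Qed.

Lemma seminorm_dist_triangle x y z : r (x - z) <= r (x - y) + r (y - z).
Proof. by apply: le_trans (seminormD _ _); rewrite addrA subrK. Qed.

Lemma seminorm_kerD x y : r y = 0 -> r (x + y) = r x.
Proof.
move=> ry; apply/le_anti/andP; split.
  by apply: le_trans (seminormD _ _) _; rewrite ry addr0.
have {1}-> : x = (x + y) - y by rewrite addrK.
by apply: le_trans (seminormD _ _) _; rewrite seminormN ry addr0.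
Qed.

Lemma seminorm_sum_le n (c : 'I_n -> K) (v : 'I_n -> V) :
  r (\sum_i c i *: v i) <= \sum_i `|c i| * r (v i).
Proof.
elim/big_ind2: _ => [|x a y b xa yb|i _]; first by rewrite seminorm0.
  by apply: le_trans (seminormD _ _) _; rewrite lerD.
by rewrite seminormZ.
Qed.

Lemma seminorm_sum_ker (I : finType) (P : pred I) (v : I -> V) :
  (forall i, P i -> r (v i) = 0) -> r (\sum_(i | P i) v i) = 0.
Proof.
move=> v0; elim/big_ind: _ => [|x y rx ry|//]; first exact: seminorm0.
by rewrite seminorm_kerD.
Qed.

End Seminorm.

Lemma small_ge0_eq0 (K : numFieldType) (c : K) :
  0 <= c -> (forall e, 0 < e -> c < e) -> c = 0.
Proof.
move=> c0 csmall; apply/eqP/contraT => cn0.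
by have := csmall c; rewrite lt_def cn0 c0 /= => /(_ isT); rewrite ltxx.
Qed.

(** * Topologies given by seminorms *)

Section SeminormTopology.
Context {K : numFieldType} {V : topologicalLmodType K} {p : nat -> V -> K}.
Hypothesis hp : increasing_seminorms p.

Lemma increasing_seminorm n : seminorm (p n). Proof. by case: hp. Qed.

Lemma seminorms_le m n x : (m <= n)%N -> p m x <= p n x.
Proof. by move=> mn; case: hp => _ pmono _; exact: (pmono x m n). Qed.

Lemma seminorms_ker_le m n x : (m <= n)%N -> p n x = 0 -> p m x = 0.
Proof.
move=> mn pn0; apply/le_anti; rewrite (seminorm_ge0 (increasing_seminorm m)) andbT.
by rewrite -pn0 seminorms_le.
Qed.

Lemma nbhs_seminormsP (x : V) (A : set V) : nbhs x A <->
  exists n (e : K), 0 < e /\ forall y, p n (y - x) < e -> A y.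
Proof.
case: hp => _ _ topp; split.
  move=> /topp[n [e [e0 sub]]]; exists n, e; split=> // y ye.
  apply: sub => i lein; apply: le_lt_trans ye; exact: seminorms_le.
move=> [n [e [e0 sub]]]; apply/topp; exists n, e; split=> // y ye.
by apply: sub; exact: ye.
Qed.

Lemma nbhs_seminorm_ball n (x : V) (e : K) :
  0 < e -> nbhs x [set y | p n (y - x) < e].
Proof. by move=> e0; apply/nbhs_seminormsP; exists n, e. Qed.

Lemma hausdorff_seminorms_eq0 (x : V) :
  hausdorff_space V -> (forall n, p n x = 0) -> x = 0.
Proof.
move=> hV px0; apply/esym; apply: hV => A B /nbhs_seminormsP[n [e [e0 subA]]].
move=> /nbhs_singleton Bx; exists x; split=> //.
by apply: subA; rewrite subr0 px0.
Qed.

(** Homogeneity: if [r < 1] on the ball of radius [e] of [p n], scaling [x]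
    into that ball bounds [r x] by [2 / e * p n x].  If [p n x = 0], then all
    multiples of [x] are in the ball, which forces [r x = 0]. *)
Lemma seminorm_dominated (r : V -> K) :
  seminorm r -> nbhs (0 : V) [set x | r x < 1] ->
  exists n (C : K), 0 < C /\ forall x, r x <= C * p n x.
Proof.
move=> hr /nbhs_seminormsP[n [e [e0 sub]]].
exists n, (2 / e); split=> [|x]; first by rewrite divr_gt0.
have sub' y : p n y < e -> r y < 1 by move=> ye; apply: sub; rewrite subr0.
have [px0|px0] := eqVneq (p n x) 0.
  rewrite px0 mulr0; have [->//|rx0] := eqVneq (r x) 0.
  have := sub' ((r x)^-1 *: x).
  rewrite !(seminormZ (increasing_seminorm n), seminormZ hr) px0 mulr0 => /(_ e0).
  by rewrite normfV ger0_norm ?(seminorm_ge0 hr) // mulVf // ltxx.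
have ppos : 0 < p n x by rewrite lt_def px0 (seminorm_ge0 (increasing_seminorm n)).
have cpos : 0 < e / (2 * p n x) by rewrite divr_gt0 // mulr_gt0.
have := sub' ((e / (2 * p n x)) *: x).
rewrite !(seminormZ (increasing_seminorm n), seminormZ hr) gtr0_norm //.
have -> : e / (2 * p n x) * p n x = e / 2.
  by rewrite invfM mulrA mulfVK.
rewrite ltr_pdivrMr // mulr_natr mulr2n ltrDl => /(_ e0).
rewrite mulrAC ltr_pdivrMr ?mulr_gt0 // mul1r => h.
by rewrite mulrAC ler_pdivlMr // mulrC; exact: ltW.
Qed.

Lemma continuous_seminorm_dominated (r : V -> K) :
  continuous_seminorm r ->
  exists n (C : K), 0 < C /\ forall x, r x <= C * p n x.
Proof.
move=> [hr rcont]; apply: seminorm_dominated => //.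
move/cvgrPdist_lt: (rcont 0) => /(_ 1 ltr01); apply: filterS => x /=.
by rewrite (seminorm0 hr) sub0r normrN ger0_norm // (seminorm_ge0 hr).
Qed.

Lemma increasing_seminorm_continuous n : continuous (p n).
Proof.
move=> x; apply/cvgrPdist_lt => e e0.
have := nbhs_seminorm_ball n x e e0; apply: filterS => y /=; apply: le_lt_trans.
have preal z : p n z \is Num.real.
  by rewrite ger0_real // (seminorm_ge0 (increasing_seminorm n)).
have dist z w : p n z - p n w <= p n (z - w).
  by rewrite lerBlDr -{1}(subrK w z) (seminormD (increasing_seminorm n)).
rewrite real_ler_norml ?rpredB // lerNl opprB dist andTb.
by rewrite (seminorm_distC (increasing_seminorm n)) dist.
Qed.

End SeminormTopology.

Section SeminormDensity.
Context {K : numFieldType} {V : topologicalLmodType K} {p : nat -> V -> K}.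
Hypothesis hp : increasing_seminorms p.

Lemma dense_seminormsP (S : set V) : dense S <->
  forall y n (e : K), 0 < e -> exists2 v, S v & p n (v - y) < e.
Proof.
split=> [dS y n e e0|H O [y Oy] Oop].
  have := nbhs_seminorm_ball hp n y e e0.
  rewrite nbhsE; case=> O [Oop Oy] sub.
  have [v [Ov Sv]] := dS O (ex_intro _ y Oy) Oop.
  by exists v => //; exact: sub.
have /(nbhs_seminormsP hp)[n [e [e0 sub]]] := open_nbhs_nbhs (conj Oop Oy).
by have [v Sv ve] := H y n e e0; exists v; split=> //; exact: sub.
Qed.

Lemma closure_seminormsP (S : set V) (y : V) : closure S y <->
  forall n (e : K), 0 < e -> exists2 v, S v & p n (v - y) < e.
Proof.
split=> [Sy n e e0|H B /(nbhs_seminormsP hp)[n [e [e0 sub]]]].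
  by have [v [? ?]] := Sy _ (nbhs_seminorm_ball hp n y e e0); exists v.
by have [v Sv ve] := H n e e0; exists v; split=> //; exact: sub.
Qed.

(** Every [ker (p m)] contains a non-zero vector, [p m] not being a norm.  Pick
    [v 0] in [ker (p n)], then [m 0] with [p (m 0) (v 0) != 0], then [v 1] in
    [ker (p (m 0))], and so on: in a linear relation [p (m i)] kills all the
    vectors after [v i], so that the coefficients vanish one after the other. *)
Lemma contains_free_sequence_ker (n : nat) :
  hausdorff_space V -> ~ (exists r : V -> K, continuous_norm r) ->
  contains_free_sequence (ker (p n)).
Proof.
move=> hV nonorm.
have sn := increasing_seminorm hp.
have nonzero m : exists v, p m v = 0 /\ v != 0.
  apply: contrapT => /forallNP kerm; apply: nonorm; exists (p m); split.
    split; first exact: sn.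
    exact: increasing_seminorm_continuous.
  apply/seteqP; split=> v /=; last by move=> ->; exact: seminorm0 (sn m).
  move=> pv; apply: contrapT => /eqP v0; exact: (kerm v).
have [f Hf] : exists f : nat -> V * nat, forall k,
    (p n (f k).1 = 0 /\ p (f k).2 (f k).1 != 0) /\
    forall i, (i < k)%N -> p (f i).2 (f k).1 = 0.
  apply: (recursive_choice (0, 0%N) (fun k a => p n a.1 = 0 /\ p a.2 a.1 != 0)
    (fun i k b a => p b.2 a.1 = 0)) => k f _.
  have [v [pv v0]] := nonzero (maxn n (\max_(i < k) (f i).2)).
  have [m pmv] : exists m, p m v != 0.
    apply: contrapT => /forallNP pmv; move/eqP: v0; apply.
    apply: (hausdorff_seminorms_eq0 hp) => // m.
    by apply: contrapT => /eqP; exact: pmv.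
  exists (v, m); split=> [|i ik] /=.
    by split=> //; apply: seminorms_ker_le hp _ _ _ _ pv; exact: leq_maxl.
  apply: seminorms_ker_le hp _ _ _ _ pv; apply: leq_trans (leq_maxr _ _).
  by rewrite (leq_bigmax (Ordinal ik)).
exists (fun k => (f k).1) => [k|m c csum].
  by have [[]] := Hf k.
elim/ltn_ind => i IH im.
have := seminorm0 (sn (f i).2); rewrite -csum (bigD1 (Ordinal im)) //=.
rewrite (seminorm_kerD (sn _)); last first.
  apply: (seminorm_sum_ker (sn _)) => k /eqP ki; rewrite (seminormZ (sn _)).
  have [ik|ki'|ik] := ltngtP i k.
  - by have [_ ->] := Hf k; rewrite ?mulr0.
  - by rewrite IH ?normr0 ?mul0r.
  - by case: ki; exact/val_inj.
rewrite (seminormZ (sn _)) => /eqP; rewrite mulf_eq0 normr_eq0.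
have [[_ /negPf->] _] := Hf i.
by rewrite orbF => /eqP.
Qed.

End SeminormDensity.

(** * Series of vectors in smaller and smaller kernels *)

(** [z] is the sum of the series of the [c s *: x s].  When [p s (x s) = 0] for
    all [s], the terms of index at least [n] belong to [ker (p n)], so that
    convergence amounts to an equality modulo each [ker (p n)]; no limit is
    needed. *)
Definition ker_series {K : numFieldType} {V : topologicalLmodType K}
    (p : nat -> V -> K) (x : nat -> V) (c : nat -> K) (z : V) : Prop :=
  forall n, p n (z - \sum_(s < n) c s *: x s) = 0.

Section KerSeries.
Context {K : numFieldType} {V : topologicalLmodType K} {p : nat -> V -> K}.
Hypothesis hp : increasing_seminorms p.
Context {x : nat -> V}.
Hypothesis hx : forall s, p s (x s) = 0.

Let sn := increasing_seminorm hp.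

Lemma ker_series_tail n m (c : nat -> K) : (n <= m)%N ->
  p n (\sum_(s < m) c s *: x s - \sum_(s < n) c s *: x s) = 0.
Proof.
move=> nm; rewrite -!(big_mkord xpredT (fun s => c s *: x s)).
rewrite (big_cat_nat (n := n)) //= addrAC subrr add0r.
rewrite -(add0n n) big_addn big_mkord.
apply: (seminorm_sum_ker (sn n)) => i _; rewrite (seminormZ (sn n)).
rewrite (seminorms_ker_le hp _ (i + n)%N) ?mulr0 //; exact: leq_addl.
Qed.

Lemma ker_series_exists (c : nat -> K) :
  tvs_complete V -> exists z, ker_series p x c z.
Proof.
move=> cV; pose S n := \sum_(s < n) c s *: x s.
have [U U0|z Sz] := cV (S @ \oo) _.
  have /(nbhs_seminormsP hp)[n [e [e0 sub]]] := U0.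
  exists [set S m | m in [set m | (n <= m)%N]].
    by exists n => // m nm; exists m.
  move=> _ _ [k nk <-] [m nm <-]; apply: sub; rewrite subr0.
  apply: le_lt_trans (seminorm_dist_triangle (sn n) _ (S n) _) _.
  rewrite (seminorm_distC (sn n) (S n)).
  by rewrite (ker_series_tail _ _ _ nk) (ker_series_tail _ _ _ nm) addr0.
exists z => n; apply: small_ge0_eq0 => [|e e0].
  exact: seminorm_ge0 (sn n) _.
have /Sz[N _ HN] := nbhs_seminorm_ball hp n z e e0.
have := HN (maxn n N) (leq_maxr _ _); rewrite /= (seminorm_distC (sn n)).
apply: le_lt_trans.
apply: le_trans (seminorm_dist_triangle (sn n) _ (S (maxn n N)) _) _.
by rewrite (ker_series_tail _ _ _ (leq_maxl _ _)) addr0.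
Qed.

Lemma ker_series_sum m (b : 'I_m -> K) (c : 'I_m -> nat -> K) (u : 'I_m -> V) :
  (forall k, ker_series p x (c k) (u k)) ->
  ker_series p x (fun s => \sum_k b k * c k s) (\sum_k b k *: u k).
Proof.
move=> cu n; under [in X in _ - X]eq_bigr do rewrite scaler_suml.
rewrite exchange_big /= -sumrB; apply: (seminorm_sum_ker (sn n)) => k _.
under eq_bigr do rewrite -scalerA.
by rewrite -scaler_sumr -scalerBr (seminormZ (sn n)) cu mulr0.
Qed.

Lemma ker_series_linear (b : K) (c d : nat -> K) (u v : V) :
  ker_series p x c u -> ker_series p x d v ->
  ker_series p x (fun s => b * c s + d s) (b *: u + v).
Proof.
move=> cu dv n; under eq_bigr do rewrite scalerDl -scalerA.
rewrite big_split /= -scaler_sumr opprD addrACA -scalerBr.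
by rewrite (seminorm_kerD (sn n)) ?dv // (seminormZ (sn n)) cu mulr0.
Qed.

Lemma ker_series_ker n (c : nat -> K) (z : V) :
  (forall s, (s < n)%N -> c s = 0) -> ker_series p x c z -> p n z = 0.
Proof.
by move=> c0 /(_ n); rewrite big1 ?subr0 // => s _; rewrite c0 ?scale0r.
Qed.

Lemma ker_series_neq0 (c : nat -> K) (z : V) : hausdorff_space V ->
  ker_series p x c z -> z != 0 -> exists s, c s != 0.
Proof.
move=> hV cz /eqP z0; apply: contrapT => /forallNP c0; apply: z0.
apply: (hausdorff_seminorms_eq0 hp) => // n; apply: ker_series_ker cz => s _.
by apply: contrapT => /eqP; exact: c0.
Qed.

(** The seminorms [rho s] detect the coefficients of a series: [rho s] ignores
    all the terms but the one of index [s]. *)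
Section Coordinates.
Context {rho : nat -> V -> K}.
Hypothesis hrho : forall s, seminorm (rho s).
Hypothesis rho_cont : forall s,
  exists n (C : K), 0 < C /\ forall v, rho s v <= C * p n v.
Hypothesis rho_diag : forall s t, s != t -> rho s (x t) = 0.

(** A continuous seminorm vanishes on a remainder of large enough index, and
    [rho s] vanishes on the other terms by biorthogonality. *)
Lemma ker_series_coord_diff (c : nat -> K) (z : V) s :
  ker_series p x c z -> rho s (z - c s *: x s) = 0.
Proof.
move=> cz; have [n [C [C0 HC]]] := rho_cont s.
have sm : (s < maxn n s.+1)%N by rewrite leq_max ltnSn orbT.
have : rho s (z - \sum_(t < maxn n s.+1) c t *: x t) = 0.
  apply/le_anti; rewrite (seminorm_ge0 (hrho s)) andbT.
  apply: le_trans (HC _) _.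
  by rewrite (seminorms_ker_le hp _ _ _ (leq_maxl n s.+1) (cz _)) mulr0.
rewrite (bigD1 (Ordinal sm)) //= opprD addrA => <-; apply/esym.
apply: (seminorm_kerD (hrho s)); rewrite (seminormN (hrho s)).
apply: (seminorm_sum_ker (hrho s)) => t ts.
by rewrite (seminormZ (hrho s)) rho_diag ?mulr0 // eq_sym.
Qed.

Lemma ker_series_coord (c : nat -> K) (z : V) s :
  ker_series p x c z -> rho s z = `|c s| * rho s (x s).
Proof.
move=> /(ker_series_coord_diff _ _ s) cz.
rewrite -(seminormZ (hrho s)) -[in LHS](subrK (c s *: x s) z) addrC.
by rewrite (seminorm_kerD (hrho s)).
Qed.

Context {l : nat -> nat}.
Hypothesis l_le : forall s, (l s <= s)%N.
Hypothesis l_surj : forall j, exists2 s, l s = j & rho s (x s) != 0.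

(** The sums whose coefficients are constant on the fibres of [l].  When
    the fibres are infinite, each coefficient governs infinitely many terms, one
    for each target that the orbit has to approach. *)
Definition ker_series_span : set V :=
  [set z | exists a : nat -> K, ker_series p x (a \o l) z].

Lemma linear_subspace_ker_series_span : linear_subspace ker_series_span.
Proof.
split=> [|b u v [c cu] [d dv]].
  exists (fun=> 0) => n; rewrite big1 ?subr0 ?(seminorm0 (sn n)) // => s _.
  by rewrite scale0r.
by exists (fun j => b * c j + d j); exact: ker_series_linear cu dv.
Qed.

(** The sums over the fibres of [l] above [n], [n + 1], ...: since [l s <= s],
    these fibres contain no index below [n], so the sums are in [ker (p n)]. *)
Lemma contains_free_sequence_ker_series_span n :
  tvs_complete V -> contains_free_sequence (ker_series_span `&` ker (p n)).
Proof.
move=> cV.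
pose a k j : K := (j == n + k)%:R.
have /choice[u Hu] k : exists u, ker_series p x (a k \o l) u.
  exact: ker_series_exists.
exists u => [k|m b bu i im].
  split; first by exists (a k).
  apply: ker_series_ker (Hu k) => s sn'; rewrite /a /= ltn_eqF //.
  exact: leq_trans (leq_ltn_trans (l_le s) sn') (leq_addr _ _).
have [s ls rs] := l_surj (n + i)%N.
have := ker_series_sum _ (fun k : 'I_m => b k) (fun k => a k \o l) _
  (fun k : 'I_m => Hu k).
move=> /(ker_series_coord _ _ s); rewrite bu (seminorm0 (hrho s)) /=.
rewrite (bigD1 (Ordinal im)) //= big1 => [|k ki].
  rewrite /a ls eqxx mulr1 addr0 => /esym/eqP.
  by rewrite mulf_eq0 normr_eq0 (negPf rs) orbF => /eqP.
rewrite /a ls eqn_add2l; have [ik|_] := eqVneq i (k : nat); last by rewrite mulr0.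
by case/eqP: ki; apply: val_inj.
Qed.

(** If [y m] in the span tends to [z], then the coefficients of [y m] form Cauchy
    sequences, as [rho s] bounds them by a seminorm of differences of the [y m].
    Modulo [ker (p n)] only the first [n] terms matter, so the series of the
    limit coefficients has sum [z]. *)
Lemma closed_ker_series_span :
  cauchy_complete_field K -> archimedean_field K -> closed ker_series_span.
Proof.
move=> cK aK z zM.
have inv0 m : 0 < m.+1%:R^-1 :> K by rewrite invr_gt0.
have /choice[y Hy] m : exists y,
    ker_series_span y /\ p m (y - z) < m.+1%:R^-1.
  move/(closure_seminormsP hp): zM => /(_ m m.+1%:R^-1 (inv0 m))[y My yz].
  by exists y.
have /choice[a Ha] m : exists a : nat -> K, ker_series p x (a \o l) (y m).
  by have [] := Hy m.
have coefs j : exists b : K, (fun m => a m j) @ \oo --> b.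
  apply: cK => e e0.
  have [s ls rs] := l_surj j; have [n [C [C0 HC]]] := rho_cont s.
  have rs0 : 0 < rho s (x s) by rewrite lt_def rs (seminorm_ge0 (hrho s)).
  (* [rho s (y i - y k)] is [rho s (x s)] times the distance of the
     coefficients, and at most [C * p n (y i - y k)]. *)
  have [|N HN] := aK (e * rho s (x s) / C / 2).
    by rewrite !divr_gt0 // mulr_gt0.
  exists (maxn n N) => i k; rewrite !geq_max => /andP[ni Ni] /andP[nk Nk].
  have := ker_series_linear (-1) _ _ _ _ (Ha k) (Ha i).
  move=> /(ker_series_coord _ _ s) /=; rewrite ls => dist.
  rewrite -(ltr_pM2r rs0) addrC -[- a k j]mulN1r -dist.
  apply: le_lt_trans (HC _) _; rewrite -ltr_pdivlMl // mulrC.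
  rewrite scaleN1r addrC.
  apply: le_lt_trans (seminorm_dist_triangle (sn n) _ z _) _.
  rewrite [X in _ < X]splitr ltrD //.
    apply: le_lt_trans _ (HN i Ni); apply: le_trans _ (ltW (Hy i).2).
    exact: (seminorms_le hp).
  rewrite (seminorm_distC (sn n)).
  apply: le_lt_trans _ (HN k Nk); apply: le_trans _ (ltW (Hy k).2).
  exact: (seminorms_le hp).
have /choice[b Hb] := coefs.
exists b => n; apply: small_ge0_eq0 => [|e e0].
  exact: seminorm_ge0 (sn n) _.
have : \sum_(s < n) `|a m (l s) - b (l s)| * p n (x s) @[m --> \oo] --> (0 : K).
  rewrite [X in _ --> X](_ : 0 = \sum_(s < n) 0 * p n (x s)); last first.
    by rewrite big1 // => s _; rewrite mul0r.
  apply: cvg_big => [|s _]; first exact: add_continuous.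
  apply: cvgM (cvg_cst _).
  rewrite -[X in _ --> X](@normr0 K K) -(subrr (b (l s))).
  by apply: cvg_norm; apply: cvgB (Hb _) _; exact: cvg_cst.
have e2 : 0 < e / 2 by rewrite divr_gt0.
move/cvgrPdist_lt => /(_ _ e2)[N1 _ HN1].
have [N2 HN2] := aK _ e2.
pose m := maxn n (maxn N1 N2).
have nm : (n <= m)%N by exact: leq_maxl.
have Nm : (N1 <= m)%N by rewrite !leq_max leqnn !orbT.
have := HN1 m Nm; rewrite /= sub0r normrN => /(le_lt_trans _) sum_small.
apply: le_lt_trans (seminorm_dist_triangle (sn n) _ (y m) _) _.
rewrite (splitr e) ltrD //.
  rewrite (seminorm_distC (sn n)).
  apply: le_lt_trans (seminorms_le hp _ _ _ nm) (lt_trans (Hy m).2 _).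
  by apply: HN2; rewrite !leq_max leqnn !orbT.
apply: le_lt_trans
  (seminorm_dist_triangle (sn n) _ (\sum_(s < n) (a m \o l) s *: x s) _) _.
rewrite Ha add0r -sumrB; apply: sum_small.
rewrite ger0_norm; last first.
  by apply: sumr_ge0 => s _; rewrite mulr_ge0 // (seminorm_ge0 (sn n)).
under [X in p n X]eq_bigr do rewrite -scalerBl.
exact: seminorm_sum_le (sn n) _ _ _.
Qed.

End Coordinates.
End KerSeries.

(** * Biorthogonal sequences for operators *)

Section SequencesOfOperators.
Context {K : numFieldType} {X Y : topologicalLmodType K}.
Context {p : nat -> X -> K} {q : nat -> Y -> K}.
Hypothesis hp : increasing_seminorms p.
Hypothesis hq : increasing_seminorms q.

Lemma seminorm_comp_linear (L : {linear X -> Y}) (r : Y -> K) :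
  seminorm r -> seminorm (r \o L).
Proof.
move=> hr; split=> [v|v w|a v] /=; first exact: seminorm_ge0.
  by rewrite linearD seminormD.
by rewrite linearZ /= seminormZ.
Qed.

Lemma continuous_linear_dominated (L : {linear X -> Y}) j : continuous L ->
  exists n (C : K), 0 < C /\ forall v, (q j \o L) v <= C * p n v.
Proof.
move=> Lcont; apply: (seminorm_dominated hp (q j \o L)).
  exact: seminorm_comp_linear (increasing_seminorm hq j).
have : nbhs (0 : X) (L @^-1` [set y | q j (y - L 0) < 1]).
  exact: Lcont (nbhs_seminorm_ball hq j (L 0) 1 ltr01).
by apply: filterS => v /=; rewrite linear0 subr0.
Qed.

(** The heart of the proof.  At step [s], [N] is large enough for [S k] with
    [N <= k] to kill the earlier vectors, and [n] large enough for the earlier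
    operators to kill [ker (p n)]; the density hypothesis for this [n] and this
    [N] then provides the new pair. *)
Lemma biorthogonal_sequence (S : nat -> {linear X -> Y}) (X0 : set X)
    (d : nat -> Y) :
  (forall k, continuous (S k)) ->
  (forall j x, X0 x -> \forall k \near \oo, q j (S k x) = 0) ->
  (forall n N, dense (\bigcup_(k in [set k | (N <= k)%N])
                        (S k @` (X0 `&` ker (p n))))) ->
  exists (x : nat -> X) (k : nat -> nat),
    [/\ forall s, p s (x s) = 0,
        forall s t, s != t -> q s (S (k s) (x t)) = 0
      & forall s, q s (S (k s) (x s) - d s) < s.+1%:R^-1].
Proof.
move=> Scont Szero Sdense.
pose Q s (xk : X * nat) := [/\ X0 xk.1, p s xk.1 = 0
  & q s (S xk.2 xk.1 - d s) < s.+1%:R^-1].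
pose P i s (yh xk : X * nat) :=
  q i (S yh.2 xk.1) = 0 /\ q s (S xk.2 yh.1) = 0.
have [f Hf] : exists f : nat -> X * nat, forall s,
    Q s (f s) /\ forall i, (i < s)%N -> P i s (f i) (f s).
  apply: (recursive_choice (0, 0%N)) => s f HQ.
  have [i _|n Hn] := uniform_threshold
      (fun i n => forall v, p n v = 0 -> q i (S (f i).2 v) = 0) s.
    have [n [C [_ HC]]] := continuous_linear_dominated _ i (Scont (f i).2).
    exists n => m nm v pv; apply/le_anti.
    rewrite (seminorm_ge0 (increasing_seminorm hq i)) andbT.
    by apply: le_trans (HC v) _; rewrite (seminorms_ker_le hp _ _ _ nm pv) mulr0.
  have [i ltis|N HN] := uniform_threshold
      (fun i k => q s (S k (f i).1) = 0) s.
    have [X0fi _ _] := HQ i ltis.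
    by have [N _ HN] := Szero s _ X0fi; exists N => k Nk; exact: HN.
  have s0 : 0 < s.+1%:R^-1 :> K by rewrite invr_gt0.
  have /(dense_seminormsP hq)/(_ (d s) s _ s0) := Sdense (maxn n s) N.
  move=> [_ [k Nk [v [X0v pv] <-]] close]; exists (v, k); split.
    split=> //=; exact: seminorms_ker_le hp _ _ _ (leq_maxr _ _) pv.
  move=> i ltis; split; last exact: HN.
  apply: Hn (leqnn _) _ _ => //.
  exact: seminorms_ker_le hp _ _ _ (leq_maxl _ _) pv.
exists (fun s => (f s).1), (fun s => (f s).2); split=> [s|s t|s].
- by have [[]] := Hf s.
- rewrite neq_ltn => /orP[st|ts].
    by have [_ /(_ s st)[]] := Hf t.
  by have [_ /(_ t ts)[]] := Hf s.
- by have [[]] := Hf s.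
Qed.

(** A continuous seminorm is dominated by some [p n], and so vanishes on
    [ker (p n)]. *)
Lemma hypercyclic_subspace_type2_of_ker (T : nat -> {linear X -> Y})
    (M : set X) :
  linear_subspace M -> closed M ->
  (forall n, contains_free_sequence (M `&` ker (p n))) ->
  (forall x, M x -> x != 0 -> hypercyclic T x) ->
  hypercyclic_subspace_type2 T M.
Proof.
move=> Mlin Mclosed Mfree Mhyp; split.
  split=> //; apply: infinite_dimensional_of_free_sequence.
  exact: contains_free_sequenceS _ _ (@subIsetl _ _ _) (Mfree 0%N).
move=> r rcont; have [n [C [C0 HC]]] := continuous_seminorm_dominated hp r rcont.
apply: infinite_dimensional_of_free_sequence.
apply: contains_free_sequenceS _ _ _ (Mfree n) => v [Mv pv]; split=> //.
apply/le_anti; rewrite /= (seminorm_ge0 rcont.1) andbT.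
by apply: le_trans (HC v) _; rewrite pv mulr0.
Qed.

End SequencesOfOperators.

(** * The hypercyclic subspace *)

Lemma countable_dense_sequence {K : numFieldType} {Y : topologicalLmodType K} :
  separable_space Y -> exists d : nat -> Y, dense (range d).
Proof.
move=> [D /countable_injP[f finj] dD].
have /choice[d Hd] i : exists y : Y, forall z, D z -> f z = i -> z = y.
  have [[z [Dz fz]]|none] := pselect (exists z, D z /\ f z = i).
    by exists z => w Dw fw; apply: finj; rewrite ?inE // fw fz.
  by exists 0 => z Dz fz; case: none; exists z.
exists d => O O0 Oop; have [y [Oy Dy]] := dD O O0 Oop.
by exists y; split=> //; exists (f y) => //; rewrite -(Hd _ _ Dy).
Qed.

(** The exponents of [2] and [3] serve as a map from indices to pairs that
    takes each value infinitely often: the power of [5] makes the index as large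
    as desired. *)
Lemma logn_fiber_unbounded (l i N : nat) :
  exists2 s, (N <= s)%N & logn 2 s = l /\ logn 3 s = i.
Proof.
exists (2 ^ l * 3 ^ i * 5 ^ N)%N.
  apply: leq_trans (ltnW (ltn_expl N (isT : (1 < 5)%N))) _.
  by rewrite leq_pmull // muln_gt0 !expn_gt0.
have pos : (0 < 2 ^ l * 3 ^ i)%N by rewrite muln_gt0 !expn_gt0.
by rewrite !lognM ?expn_gt0 // !lognX !logn_prime //= !muln0 !muln1 !addn0.
Qed.

Lemma logn_le (b s : nat) : (logn b s <= s)%N.
Proof. by case: s => [|s]; [rewrite logn0 | rewrite ltnW // ltn_logl]. Qed.

Theorem theorem3p3 (R : realType) (K : numFieldType)
  (hK : K = (R : numFieldType) \/ K = (R[i] : numFieldType))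
  (X : topologicalLmodType K) (p : nat -> X -> K)
  (hXdim : infinite_dimensional [set: X])
  (hX : frechet_space X)
  (hnorm : ~ exists r : X -> K, continuous_norm r)
  (hp : increasing_seminorms p)
  (Y : topologicalLmodType K) (q : nat -> Y -> K)
  (hY : separable_space Y)
  (hq : increasing_seminorms q)
  (T : nat -> {linear X -> Y})
  (hT : forall k, continuous (T k))
  (nk : nat -> nat) (hnk : increasing_seq nk) (X0 : set X)
  (hzero : forall (j : nat) (x : X), X0 x ->
     \forall k \near \oo, q j (T (nk k) x) = 0)
  (hdense : forall n N : nat,
     dense (\bigcup_(k in [set k | (N <= k)%N])
              (T (nk k) @` (X0 `&` ker (p n))))) :
  exists M : set X, hypercyclic_subspace_type2 T M.
Proof.
have [hausX compX _] := hX.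
have cK : cauchy_complete_field K.
  case: hK => ->; first exact: real_cauchy_complete.
  exact: complex_cauchy_complete.
have aK : archimedean_field K.
  by case: hK => ->; [exact: real_archimedean | exact: complex_archimedean].
have sq := increasing_seminorm hq.
have [q0|] := pselect (forall j y, q j y = 0).
  exists setT; apply: (hypercyclic_subspace_type2_of_ker hp).
  - by [].
  - exact: closedT.
  - by move=> n; rewrite setTI; exact: contains_free_sequence_ker.
  - move=> x _ _; apply/(dense_seminormsP hq) => y j e e0.
    by exists (T 0%N x); [exists 0%N | rewrite q0].
move=> /existsNP[J /existsNP[y0 /eqP qy0]].
have [d ddense] := countable_dense_sequence hY.
have [x [k [hx diag close]]] := biorthogonal_sequence hp hq
  (fun m => T (nk m)) X0 (fun s => d (logn 3 s)) (fun m => hT (nk m))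
  hzero hdense.
pose rho s := q s \o T (nk (k s)).
have rho_sn s : seminorm (rho s) by exact: seminorm_comp_linear.
have rho_cont s := continuous_linear_dominated hp hq _ s (hT (nk (k s))).
have approx l y j e : 0 < e -> exists s,
    [/\ (j <= s)%N, logn 2 s = l & q j (T (nk (k s)) (x s) - y) < e].
  move=> e0; have e2 : 0 < e / 2 by rewrite divr_gt0.
  move/(dense_seminormsP hq): ddense => /(_ y j _ e2)[_ [i _ <-] dy].
  have [N HN] := aK _ e2.
  have [s js [sl si]] := logn_fiber_unbounded l i (maxn j N).
  move: js; rewrite geq_max => /andP[js Ns].
  exists s; split=> //.
  apply: le_lt_trans (seminorm_dist_triangle (sq j) _ (d i) _) _.
  rewrite (splitr e) ltrD //; apply: lt_trans (HN s Ns).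
  by apply: le_lt_trans (seminorms_le hq _ _ _ js) _; rewrite -si.
(* If [rho s (x s)] vanished for all [s] in the fibre, then the vectors
   [T (nk (k s)) (x s)] could not approach [y0], as [q J y0 != 0]. *)
have l_surj l : exists2 s, logn 2 s = l & rho s (x s) != 0.
  have qy0_gt0 : 0 < q J y0 by rewrite lt_def qy0 (seminorm_ge0 (sq J)).
  have [s [Js sl]] := approx l y0 J _ qy0_gt0.
  move=> close0; exists s => //; apply: contraTneq close0 => rho0.
  rewrite addrC (seminorm_kerD (sq J)); last exact: (seminorms_ker_le hq _ s).
  by rewrite (seminormN (sq J)) ltxx.
exists (ker_series_span (p := p) (x := x) (l := logn 2)).
apply: (hypercyclic_subspace_type2_of_ker hp).
- exact: linear_subspace_ker_series_span.
- exact: closed_ker_series_span l_surj cK aK.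
- move=> n; apply: contains_free_sequence_ker_series_span l_surj _ _ => //.
  by move=> s; exact: logn_le.
- move=> z [a az] z0.
  have [s0 /= as0] := ker_series_neq0 hp _ _ hausX az z0.
  set b := a _ in as0.
  apply/(dense_seminormsP hq) => y j e e0.
  have b0 : 0 < `|b| by rewrite normr_gt0.
  (* [T (nk (k s)) z] is [b] times a vector close to [b^-1 *: y]. *)
  have [s [js sl qs]] := approx (logn 2 s0) (b^-1 *: y) j _ (divr_gt0 e0 b0).
  exists (T (nk (k s)) z); first by exists (nk (k s)).
  have := ker_series_coord_diff hp rho_sn rho_cont diag _ _ s az.
  rewrite /rho /= sl -/b linearB linearZ /=.
  move=> /(seminorms_ker_le hq _ _ _ js) Tz.
  apply: le_lt_trans
    (seminorm_dist_triangle (sq j) _ (b *: T (nk (k s)) (x s)) _) _.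
  have -> : b *: T (nk (k s)) (x s) - y
      = b *: (T (nk (k s)) (x s) - b^-1 *: y).
    by rewrite scalerBr scalerA mulfV // scale1r.
  by rewrite Tz add0r (seminormZ (sq j)) mulrC -ltr_pdivlMr.
Qed.
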